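(* Let $G$ be a finite group with identity $e$, and let $X\in M_{|G|}(\mathcal A)$ be self-adjoint, free from $M_{|G|}(\mathbb C)$ with respect to $\varphi$, and with distribution $\mu$. Let $X^t=\sum_{g\in G}Y_g$ be the left $G$-circulant decomposition of $X^t$, and let $S=\{g\in G: g=g^{-1}\neq e\}$. Then for every $g\in S$ the distribution of $Y_g$ is $$\mu_{Y_g}=\big(D_{\frac1{|G|}}\mu\big)^{\boxplus \frac{|G|}2}\boxplus\big(D_{-\frac1{|G|}}\mu\big)^{\boxplus \frac{|G|}2}.$$
   Context: $(\mathcal A,\tau)$ is a $*$-probability space (unital complex $*$-algebra with a linear functional $\tau$, $\tau(1)=1$) with $\tau$ tracial. $M_{|G|}(\mathcal A)$ carries $\varphi(A)=\frac1{|G|}\sum_{h\in G}\tau(A_{h,h})$ and contains $M_{|G|}(\mathbb C)$ via $\mathbb C\cdot1\subset\mathcal A$; rows and columns are indexed by $G$ through a fixed enumeration. ''$X$ is free from $M_{|G|}(\mathbb C)$'' means that the unital algebra generated by $X$ and $M_{|G|}(\mathbb C)$ are freely independent with respect to $\varphi$. Transpose: $(X^t)_{p,q}=X_{q,p}$. Left $G$-circulant decomposition of $A\in M_{|G|}(\mathcal A)$: $A=\sum_{g\in G}A_g$ with $(A_g)_{p,q}=A_{p,q}$ if $q=gp$ and $0$ otherwise. The distribution of an element $a$ is determined by its moments $\varphi(a^n)$, $n\ge1$ (equivalently by its free cumulants $\kappa_n(a):=\kappa_n(a,\dots,a)$); it is identified with a probability measure having these moments when appropriate. $D_c\mu$ denotes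 the dilation of $\mu$ by $c$ (the distribution of $ca$ if $a$ has distribution $\mu$), with $\kappa_n(D_c\mu)=c^n\kappa_n(\mu)$; $\boxplus$ is free additive convolution, $\kappa_n(\mu\boxplus\nu)=\kappa_n(\mu)+\kappa_n(\nu)$; and $\mu^{\boxplus t}$ is the free convolution power, $\kappa_n(\mu^{\boxplus t})=t\,\kappa_n(\mu)$. *)

(* Defs.v *)
From mathcomp Require Import all_boot all_order all_algebra all_fingroup.
From mathcomp Require Import reals complex.

Set Implicit Arguments.
Unset Strict Implicit.
Unset Printing Implicit Defensive.

Import GRing.Theory Num.Theory.

Local Open Scope ring_scope.

Definition noncrossing n (pi : {set {set 'I_n}}) : bool :=
  [forall V in pi, forall W in pi, (V != W) ==>
    ~~ [exists a in V, exists b in W, exists c in V, exists d in W,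
         [&& (a < b)%N, (b < c)%N & (c < d)%N]]].

Definition NC n : {set {set {set 'I_n}}} :=
  [set pi | partition pi [set: 'I_n] & noncrossing pi].

(* A distribution is encoded by its sequence of moments [mu n], [n >= 1]; the
   moment of index 0 is always 1. *)
Section Cumulants.
Variable K : comNzRingType.
Implicit Types (mu nu kappa : nat -> K) (n : nat) (c t : K).

(* The moment-cumulant formula.  For [n = 0] the sum has a single term, given
   by the empty partition, and its value is 1. *)
Definition moments_of_cumulants kappa n : K :=
  \sum_(pi in NC n) \prod_(V in pi) kappa #|V|.

(* The moment-cumulant formula solved for [kappa n], the cumulant attached to
   the one-block partition.  [N] bounds the depth of the recursion. *)
Fixpoint cumulant_rec mu (N : nat) n : K :=
  if N is N'.+1 then
    mu n - \sum_(pi in NC n | pi != [set [set: 'I_n]])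
              \prod_(V in pi) cumulant_rec mu N' #|V|
  else 0.

Definition free_cumulant mu n : K := cumulant_rec mu n n.

Definition dilation c mu n : K := c ^+ n * mu n.

Definition free_conv mu nu : nat -> K :=
  moments_of_cumulants (fun n => free_cumulant mu n + free_cumulant nu n).

Definition free_conv_power mu t : nat -> K :=
  moments_of_cumulants (fun n => t * free_cumulant mu n).

Lemma one_block_NC n : (0 < n)%N -> [set [set: 'I_n]] \in NC n.
Proof.
case: n => // n _; rewrite inE; apply/andP; split.
  apply/and3P; split; first by rewrite /cover big_set1.
    by apply/trivIsetP => A B /set1P-> /set1P->; rewrite eqxx.
  by rewrite inE eq_sym; apply/set0Pn; exists ord0.
apply/forall_inP => V /set1P->; apply/forall_inP => W /set1P->.
by rewrite eqxx.
Qed.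

Lemma NC_block_gt0 n (pi : {set {set 'I_n}}) (V : {set 'I_n}) :
  pi \in NC n -> V \in pi -> (0 < #|V|)%N.
Proof.
rewrite inE => /andP[/and3P[_ _ h0] _] hV; rewrite card_gt0.
by apply: contraNneq h0 => <-.
Qed.

Lemma NC_block_lt n (pi : {set {set 'I_n}}) (V : {set 'I_n}) :
  pi \in NC n -> pi != [set [set: 'I_n]] -> V \in pi -> (#|V| < n)%N.
Proof.
move=> hpi hne hV; have gt0 := NC_block_gt0 hpi.
have : (#|V| <= n)%N by rewrite -[n in (_ <= n)%N]card_ord max_card.
rewrite leq_eqVlt => /orP[/eqP cV|//]; case/negP: hne.
move: (hpi); rewrite inE => /andP[hp _].
have := card_partition hp; rewrite cardsT card_ord (bigD1 V) //= cV.
move/eqP; rewrite -{1}[n]addn0 eqn_add2l eq_sym sum_nat_eq0 => /forall_inP h.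
have VT : V = [set: 'I_n].
  by apply/eqP; rewrite eqEcard subsetT cardsT card_ord cV leqnn.
rewrite eqEsubset sub1set -VT hV andbT; apply/subsetP => W hW; rewrite inE.
by apply: contraTT (gt0 _ hW) => WV; rewrite (eqP (h W _)) ?hW.
Qed.

Lemma moments_of_cumulants_split kappa n : (0 < n)%N ->
  moments_of_cumulants kappa n =
  kappa n + \sum_(pi in NC n | pi != [set [set: 'I_n]])
              \prod_(V in pi) kappa #|V|.
Proof.
move=> n0; rewrite /moments_of_cumulants (bigD1 _ (one_block_NC n0)) /=.
by rewrite big_set1 cardsT card_ord.
Qed.

Lemma cumulant_recE mu N n :
  (0 < n <= N)%N -> cumulant_rec mu N n = free_cumulant mu n.
Proof.
rewrite /free_cumulant; move: {2}n (leqnn n) => m.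
elim: m N n => [|m IHm] N n; first by case: n.
case: N n => [|N] [|n] //= hm hN; congr (_ - _); apply: eq_bigr.
move=> pi /andP[hpi hne]; apply: eq_bigr => V hV.
have lt1 := NC_block_lt hpi hne hV; have gt0 := NC_block_gt0 hpi hV.
have len : (#|V| <= n)%N by [].
by rewrite !IHm ?gt0 //= (leq_trans len).
Qed.

Lemma moment_cumulant mu n : (0 < n)%N ->
  mu n = \sum_(pi in NC n) \prod_(V in pi) free_cumulant mu #|V|.
Proof.
case: n => // n _; rewrite -/(moments_of_cumulants _ _).
rewrite moments_of_cumulants_split // {1}/free_cumulant /=.
rewrite -addrA -[LHS]addr0; congr (_ + _); apply/esym/eqP.
rewrite addrC subr_eq0; apply/eqP; apply: eq_bigr => pi /andP[hpi hne].
apply: eq_bigr => V hV; rewrite cumulant_recE // (NC_block_gt0 hpi hV).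
exact: (NC_block_lt hpi hne hV).
Qed.

Lemma free_cumulant_uniq mu kappa :
  (forall n, (0 < n)%N -> mu n = moments_of_cumulants kappa n) ->
  forall n, (0 < n)%N -> free_cumulant mu n = kappa n.
Proof.
move=> h; elim/ltn_ind => n IHn n0; have := h _ n0.
rewrite moment_cumulant // -/(moments_of_cumulants _ _).
rewrite !moments_of_cumulants_split //.
rewrite (_ : \sum_(pi in NC n | _) _ =
  \sum_(pi in NC n | pi != [set [set: 'I_n]]) \prod_(V in pi) kappa #|V|).
  exact: addIr.
apply: eq_bigr => pi /andP[hpi hne]; apply: eq_bigr => V hV.
by rewrite IHn ?(NC_block_gt0 hpi hV) // (NC_block_lt hpi hne hV).
Qed.

Lemma free_cumulant_conv mu nu n : (0 < n)%N ->
  free_cumulant (free_conv mu nu) n = free_cumulant mu n + free_cumulant nu n.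
Proof. by move: n; apply: free_cumulant_uniq. Qed.

Lemma free_cumulant_conv_power mu t n : (0 < n)%N ->
  free_cumulant (free_conv_power mu t) n = t * free_cumulant mu n.
Proof. by move: n; apply: free_cumulant_uniq. Qed.

Lemma free_cumulant_dilation c mu n : (0 < n)%N ->
  free_cumulant (dilation c mu) n = c ^+ n * free_cumulant mu n.
Proof.
move: n; apply: free_cumulant_uniq => n n0.
rewrite /dilation (moment_cumulant mu n0) mulr_sumr; apply: eq_bigr => pi.
rewrite inE big_split => /andP[hp _]; congr (_ * _) => /=.
by rewrite prodrXr -(card_partition hp) cardsT card_ord.
Qed.

End Cumulants.

Section Probability.
Variables (C : numClosedFieldType) (A : algType C).

Record is_star (star : A -> A) : Prop := IsStar {
  starD : forall a b, star (a + b) = star a + star b;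
  starZ : forall (c : C) a, star (c *: a) = c^* *: star a;
  starM : forall a b, star (a * b) = star b * star a;
  starK : forall a, star (star a) = a
}.

Definition tracial (tau : A -> C) : Prop := forall a b, tau (a * b) = tau (b * a).

Section Matrices.
Variable n : nat.
Implicit Types (M N : 'M[A]_n) (P Q : 'M[A]_n -> Prop).

Definition selfadjoint (star : A -> A) M : Prop := map_mx star M^T = M.

Definition mx_state (tau : A -> C) M : C := n%:R^-1 * \sum_(h < n) tau (M h h).

(* The scalar [c : C] acts on matrices over [A] through [c%:A]. *)
Record is_unital_subalgebra P : Prop := IsUnitalSubalgebra {
  subalgebra1 : P 1;
  subalgebraD : forall M N, P M -> P N -> P (M + N);
  subalgebraZ : forall (c : C) M, P M -> P (c%:A *: M);
  subalgebraM : forall M N, P M -> P N -> P (M * N)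
}.

Definition unital_algebra_gen M N : Prop :=
  forall P, is_unital_subalgebra P -> P M -> P N.

Definition complex_matrix M : Prop :=
  exists B : 'M[C]_n, M = map_mx (fun c : C => c%:A) B.

End Matrices.
End Probability.

Definition distribution (C : numClosedFieldType) (B : pzRingType)
  (phi : B -> C) (b : B) (k : nat) : C := phi (b ^+ k).

(* The product is the ordered one [b 0 * b 1 * ... * b (k - 1)]; the case [k = 0]
   has to be excluded because the empty product is [1]. *)
Definition freely_independent (C : numClosedFieldType) (B : pzRingType)
    (phi : B -> C) (I : Type) (alg : I -> B -> Prop) : Prop :=
  forall (k : nat) (i : nat -> I) (b : nat -> B), (0 < k)%N ->
    (forall j, (j < k)%N -> alg (i j) (b j)) ->
    (forall j, (j < k)%N -> phi (b j) = 0) ->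
    (forall j, (j.+1 < k)%N -> i j <> i j.+1) ->
  phi (\prod_(0 <= j < k) b j) = 0.

Definition free_from_complex_matrices (C : numClosedFieldType) (A : algType C)
    (tau : A -> C) n (M : 'M[A]_n) : Prop :=
  freely_independent (mx_state tau)
    (fun s : bool => if s then unital_algebra_gen M else @complex_matrix C A n).

(* Rows and columns are indexed by [G] through its enumeration [enum_val]. *)
Definition left_circulant (G : finGroupType) (V : nmodType) (g : G)
    (M : 'M[V]_#|G|) : 'M[V]_#|G| :=
  \matrix_(p, q) if enum_val q == (g * enum_val p)%g then M p q else 0.

Lemma left_circulant_decomposition (G : finGroupType) (V : nmodType)
    (M : 'M[V]_#|G|) : M = \sum_(g : G) left_circulant g M.
Proof.
apply/matrixP => p q; rewrite summxE.
rewrite (bigD1 (enum_val q * (enum_val p)^-1)%g) //= mxE mulgKV eqxx.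
rewrite big1 ?addr0 // => g hg; rewrite mxE; case: eqP => // e.
by case/eqP: hg; rewrite e mulgK.
Qed.

(* Main.v *)
Require Import Defs.
From HB Require Import structures.
From mathcomp Require Import all_boot all_order all_algebra all_fingroup.
From mathcomp Require Import reals complex zify.
Import GRing.Theory Num.Theory.
Local Open Scope ring_scope.

(** Put [N = #|G|] and let [sigma] be the fixed-point-free involution of the
    index set given by left multiplication by [g]. The matrix [Y_g] only joins
    [i] to [sigma i], so with [j = sigma i] the diagonal entries of its powers
    are words [X_ij X_ji X_ij ...] in two entries of [X], that is, entries of
    the words [E_i X E_j X E_i ...] in [X] and diagonal matrix units. Freeness
    makes a block of [s] entries of [X] contribute [N^(1-s) kappa_s] when the
    indices of the block match up cyclically and [0] otherwise. Here they match
    exactly when the block alternates between [X_ij] and [X_ji], which needs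
    [s] even; and if all blocks of a noncrossing partition have even size,
    then all of them do alternate. So the cumulants of [Y_g] are
    [N^(1-s) kappa_s] for even [s] and [0] for odd [s], and this is
    [N/2 (N^-s + (-N)^-s) kappa_s], the cumulant of the convolution in the
    theorem ([free_conv_dilations]).

    The proof below reaches these cumulants through one-sided recursions rather
    than through mixed cumulants. Suppose that
    [x f_k = f_(k+1) + kappa_1 f_k + ... + kappa_(k+1) f_0], that
    [phi (f_0) = 1] and that [phi (f_k) = 0] for [k > 0]. Then [phi (x^n f_0)]
    is the [n]-th moment belonging to the cumulants [kappa]: the coefficients
    of [x^n f_0] along the [f_k] count weighted Lukasiewicz paths
    ([lukasiewicz_expansion]), and such paths ending at height [0] have the
    same weights as noncrossing partitions
    ([moments_of_cumulants_lukasiewicz]).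

    Read backwards for [x = X], this shows that the free Appell polynomials of
    [X] are centered ([appell_centered]). They and the centered matrices
    [N E_i - 1] are the letters of a sequence, consisting of sums of reduced
    words, that satisfies the recursion for the words [E_i X E_j X ...]
    ([alternating_sums], [alternating_moments]); freeness says exactly that
    reduced words have expectation [0] ([phi_reduced]), so the principle
    applies again and yields the moments of [Y_g]
    ([transposed_part_moments]). *)

Set Implicit Arguments.
Unset Strict Implicit.
Unset Printing Implicit Defensive.

(** * Weighted Lukasiewicz paths *)

Section Lukasiewicz.
Variables (K : comNzRingType) (kappa : nat -> K).

(** Total weight of the paths that go from height [0] to height [h] in [n] steps
    within the nonnegative integers, a step going either up by [1], with weight
    [1], or down by [s >= 0], with weight [kappa s.+1]. Only [s < n] can occur in
    the last of [n] steps. *)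
Fixpoint lukasiewicz n h : K :=
  if n is n'.+1 then
    (if h is h'.+1 then lukasiewicz n' h' else 0) +
    \sum_(s < n) kappa s.+1 * lukasiewicz n' (h + s)%N
  else (h == 0%N)%:R.

Lemma lukasiewicz0 h : lukasiewicz 0 h = (h == 0%N)%:R. Proof. by []. Qed.

Lemma lukasiewicz_gt n h : (n < h)%N -> lukasiewicz n h = 0.
Proof.
elim: n h => [|n IHn] [|h] //= lt_nh; rewrite IHn // add0r big1 // => s _.
by rewrite IHn ?mulr0 //; lia.
Qed.

Lemma lukasiewiczS n h m : (n < m)%N ->
  lukasiewicz n.+1 h = (if h is h'.+1 then lukasiewicz n h' else 0) +
               \sum_(s < m) kappa s.+1 * lukasiewicz n (h + s)%N.
Proof.
move=> lt_nm; congr (_ + _).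
rewrite (big_ord_widen m (fun s => kappa s.+1 * lukasiewicz n (h + s)%N)) //.
rewrite big_mkcond; apply: eq_bigr => s _; case: ifP => // hs.
by rewrite lukasiewicz_gt ?mulr0 //; lia.
Qed.

Arguments lukasiewicz : simpl never.

(** A path ending at height [h.+1] is cut at its last step from [h] to [h.+1]:
    what follows never returns below [h.+1], hence is a path from [0] to [0] up
    to translation. *)
Lemma lukasiewicz_convolution n h :
  lukasiewicz n.+1 h.+1 = \sum_(j < n.+1) lukasiewicz (n - j)%N 0 * lukasiewicz j h.
Proof.
elim: n h => [|n IHn] h.
  rewrite big_ord1 (lukasiewiczS _ (ltnSn 0)) big_ord1.
  by rewrite subnn !lukasiewicz0 mul1r mulr0 addr0.
rewrite (lukasiewiczS h.+1 (ltnSn n.+1)).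
under eq_bigr => s _ do rewrite addSn IHn mulr_sumr.
rewrite exchange_big /=.
have -> : \sum_(j < n.+1) \sum_(s < n.+2)
      kappa s.+1 * (lukasiewicz (n - j)%N 0 * lukasiewicz j (h + s)%N)
  = \sum_(j < n.+1) lukasiewicz (n - j)%N 0 *
      (lukasiewicz j.+1 h - (if h is h'.+1 then lukasiewicz j h' else 0)).
  apply: eq_bigr => j _; rewrite (lukasiewiczS h (m := n.+2)); last by have := ltn_ord j; lia.
  by rewrite addrC addKr mulr_sumr; apply: eq_bigr => s _; rewrite mulrCA.
rewrite [RHS]big_ord_recl subn0 /=.
under eq_bigr => j _ do rewrite mulrBr.
rewrite big_split /= addrCA addrC; congr (_ + _).
rewrite sumrN; case: h => [|h] /=.
  by rewrite mulr1 big1 ?subr0 // => j _; rewrite mulr0.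
by rewrite -IHn subrr mulr0.
Qed.

Lemma lukasiewicz_diag n : lukasiewicz n n = 1.
Proof.
elim: n => // n IHn; rewrite (lukasiewiczS _ (ltnSn n)) IHn big1 ?addr0 // => s _.
by rewrite lukasiewicz_gt ?mulr0 //; lia.
Qed.
End Lukasiewicz.
Arguments lukasiewicz : simpl never.

(** * Noncrossing partitions of intervals *)

Section NoncrossingSums.
Variables (K : comNzRingType) (kappa : nat -> K) (n : nat).
Implicit Types (S E B V W : {set 'I_n}) (rho pi : {set {set 'I_n}}).

Definition crossing V W :=
  [exists a in V, exists b in W, exists c in V, exists d in W,
     [&& (a < b)%N, (b < c)%N & (c < d)%N]].

Lemma crossingP V W :
  reflect (exists a b c d : 'I_n,
     [/\ a \in V, b \in W, c \in V, d \in W & [&& (a < b)%N, (b < c)%N & (c < d)%N]])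
    (crossing V W).
Proof.
apply: (iffP exists_inP) => [[a aV /exists_inP[b bW /exists_inP[c cV /exists_inP[d dW h]]]]|].
  by exists a, b, c, d.
move=> [a [b [c [d [aV bW cV dW h]]]]]; exists a => //; apply/exists_inP; exists b => //.
by apply/exists_inP; exists c => //; apply/exists_inP; exists d.
Qed.

Lemma crossingS V V' W W' :
  V \subset V' -> W \subset W' -> crossing V W -> crossing V' W'.
Proof.
move=> /subsetP sV /subsetP sW /crossingP[a [b [c [d [/sV aV /sW bW /sV cV /sW dW h]]]]].
by apply/crossingP; exists a, b, c, d.
Qed.

Lemma noncrossingP pi :
  reflect (forall V W, V \in pi -> W \in pi -> crossing V W -> V = W)
    (noncrossing pi).
Proof.
apply: (iffP forall_inP) => [h V W Vpi Wpi cVW|h V Vpi].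
  have /forall_inP/(_ W Wpi) := h V Vpi.
  by move=> /implyP; rewrite -/(crossing V W) cVW; case: eqP => // _ /(_ isT).
apply/forall_inP => W Wpi; apply/implyP => neVW; rewrite -/(crossing V W).
by apply: contraNN neVW => cVW; rewrite (h V W).
Qed.

Definition weight pi : K := \prod_(V in pi) kappa #|V|.

(** The set [B] stands for a block of a larger partition that has been set apart:
    its weight is left out, yet the other blocks must not cross it. With
    [B = set0] this is the plain sum over the noncrossing partitions of [E]. *)
Definition nc_sum E B : K :=
  \sum_(rho | partition rho E && noncrossing (B |: rho)) weight rho.

Definition interval l u : {set 'I_n} := [set y : 'I_n | (l <= y < u)%N].

Lemma notin_partition rho E B y : partition rho E -> y \in B -> y \notin E -> B \notin rho.
Proof.
by move=> hr yB; apply: contraNN => Br; apply: (subsetP (partitionS hr Br)).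
Qed.

Lemma noncrossing_setU1 B rho :
  (forall V, ~~ crossing V B && ~~ crossing B V) ->
  noncrossing (B |: rho) = noncrossing rho.
Proof.
move=> hB; apply/noncrossingP/noncrossingP => h V W Vr Wr cVW.
  by apply: h; rewrite ?setU1r.
case/setU1P: Vr cVW => [->|Vr]; first by case/andP: (hB W) => _ /negPf->.
by case/setU1P: Wr => [->|Wr]; [case/andP: (hB V) => /negPf-> | apply: h].
Qed.

Lemma noncrossing_set0U rho : noncrossing (set0 |: rho) = noncrossing rho.
Proof.
apply: noncrossing_setU1 => V; apply/andP; split; apply/crossingP.
  by move=> [a [b [c [d []]]]]; rewrite !inE.
by move=> [a [b [c [d []]]]]; rewrite !inE.
Qed.

Lemma noncrossing_set1U x rho : noncrossing ([set x] |: rho) = noncrossing rho.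
Proof.
apply: noncrossing_setU1 => V; apply/andP; split; apply/crossingP.
  by move=> [a [b [c [d [_ /set1P-> _ /set1P-> h]]]]]; lia.
by move=> [a [b [c [d [/set1P-> _ /set1P-> _ h]]]]]; lia.
Qed.

Lemma nc_sum_block S (x : 'I_n) : x \in S ->
  nc_sum S set0 =
  \sum_(B : {set 'I_n} | (x \in B) && (B \subset S)) kappa #|B| * nc_sum (S :\: B) B.
Proof.
move=> xS; rewrite /nc_sum.
rewrite (partition_big (fun rho => pblock rho x)
   (fun B : {set 'I_n} => (x \in B) && (B \subset S))) /=; last first.
  move=> rho /andP[hr _]; have xc : x \in cover rho by rewrite (cover_partition hr).
  by rewrite mem_pblock xc (partitionS hr) // pblock_mem.
apply: eq_bigr => B /andP[xB BS]; rewrite mulr_sumr.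
rewrite (reindex_onto (fun rho => B |: rho) (fun rho => rho :\ B)) /=; last first.
  move=> rho /andP[/andP[hr _] /eqP hB]; rewrite setD1K // -hB pblock_mem //.
  by rewrite (cover_partition hr).
have key rho : B \notin rho ->
   partition (B |: rho) S = partition rho (S :\: B).
  move=> Br; apply/idP/idP => hp.
    case/and3P: (hp) => /eqP hc ht h0; apply/and3P; split.
    - apply/eqP/setP => y; rewrite !inE -hc; apply/bigcupP/andP.
        move=> [V Vr yV]; split; last by apply/bigcupP; exists V; rewrite // setU1r.
        apply/negP => yB; move/trivIsetP: ht => /(_ V B).
        rewrite setU11 setU1r // => /(_ isT isT).
        case: eqP => [e|_]; first by rewrite -e Vr in Br.
        by move=> /(_ isT) /disjoint_setI0 /setP/(_ y); rewrite !inE yV yB.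
      move=> [yB /bigcupP[V /setU1P[->|Vr] yV]]; first by rewrite yV in yB.
      by exists V.
    - by apply: trivIsetS ht; rewrite subsetUr.
    - by apply: contraNN h0; apply: setU1r.
  have Bn0 : B != set0 by apply/set0Pn; exists x.
  have := partitionU1 hp Bn0.
  have -> : B :|: S :\: B = S.
    by apply/setP => y; rewrite !inE; case yB: (y \in B); rewrite //= (subsetP BS).
  apply; rewrite -setI_eq0; apply/eqP/setP => y; rewrite !inE.
  by case: (y \in B).
apply: eq_big => [rho|rho].
  case Br: (B \in rho).
    rewrite [RHS]andbC; apply/idP/idP.
      by move=> /andP[_ /eqP h]; move: Br; rewrite -h !inE eqxx.
    move=> /andP[_ hp]; suff: B \notin rho by rewrite Br.
    by apply: (notin_partition hp xB); rewrite !inE xB.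
  rewrite setU1K ?Br // eqxx andbT key ?Br //.
  rewrite noncrossing_set0U; case hp: (partition _ _) => //=.
  case: noncrossing => //=; apply/eqP; apply: def_pblock; rewrite ?setU11 //.
  by have := hp; rewrite -key ?Br // => /and3P[].
move=> /andP[/andP[/andP[hp _] _] /eqP h].
have Br : B \notin rho by rewrite -h !inE eqxx.
by rewrite /weight big_setU1.
Qed.

Lemma nc_sum_set1 E x : nc_sum E [set x] = nc_sum E set0.
Proof. by apply: eq_bigl => rho; rewrite noncrossing_set1U noncrossing_set0U. Qed.

(** This characterizes the image of the union map on pairs of partitions, so
    that a sum over partitions respecting [E1] and [E2] becomes a product. *)
Lemma partitionU (E1 E2 : {set 'I_n}) rho1 rho2 : [disjoint E1 & E2] ->
  [&& partition (rho1 :|: rho2) (E1 :|: E2),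
      [forall V in rho1, V \subset E1] & [forall V in rho2, V \subset E2]] =
  partition rho1 E1 && partition rho2 E2.
Proof.
move=> dE; apply/and3P/andP => [[hp /forall_inP h1 /forall_inP h2]|[hp1 hp2]]; last first.
  split; try by apply/forall_inP => V; apply: partitionS.
  apply/and3P; split.
  - by rewrite /cover bigcup_setU -/(cover rho1) -/(cover rho2)
      (cover_partition hp1) (cover_partition hp2).
  - apply/trivIsetP => V W; rewrite !inE => Vr Wr neVW.
    case/and3P: (hp1) => _ /trivIsetP t1 _; case/and3P: (hp2) => _ /trivIsetP t2 _.
    case/orP: Vr => Vr; case/orP: Wr => Wr; first exact: t1; last exact: t2.
      by apply: disjointW dE; apply: partitionS; eauto.
    by rewrite disjoint_sym; apply: disjointW dE; apply: partitionS; eauto.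
  - by rewrite inE negb_or; case/and3P: hp1 => _ _ ->; case/and3P: hp2.
case/and3P: hp => /eqP hc ht h0.
have nE y : y \in E1 -> y \in E2 -> False.
  by move=> y1 y2; move/disjoint_setI0: dE => /setP/(_ y); rewrite !inE y1 y2.
split; apply/and3P; split.
- rewrite eqEsubset; apply/andP; split; first by apply/bigcupsP.
  apply/subsetP => y yE; have : y \in cover (rho1 :|: rho2) by rewrite hc inE yE.
  case/bigcupP => V /setUP[Vr|Vr] yV; first by apply/bigcupP; exists V.
  by case: (nE y yE); apply: (subsetP (h2 V Vr)).
- by apply: trivIsetS ht; apply: subsetUl.
- by apply: contraNN h0; rewrite inE => ->.
- rewrite eqEsubset; apply/andP; split; first by apply/bigcupsP.
  apply/subsetP => y yE; have : y \in cover (rho1 :|: rho2) by rewrite hc inE yE orbT.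
  case/bigcupP => V /setUP[Vr|Vr] yV; last by apply/bigcupP; exists V.
  by case: (nE y _ yE); apply: (subsetP (h1 V Vr)).
- by apply: trivIsetS ht; apply: subsetUr.
- by apply: contraNN h0; rewrite inE => ->; rewrite orbT.
Qed.

Lemma crossing_interval l u V W : V \subset interval l u ->
  [disjoint W & interval l u] -> ~~ crossing V W && ~~ crossing W V.
Proof.
move=> /subsetP sV /disjoint_setI0/setP dW.
have outW y : y \in W -> ~~ (l <= y < u)%N.
  by move=> yW; move: (dW y); rewrite !inE yW /= => ->.
apply/andP; split; apply/crossingP => -[a [b [c [d [h1 h2 h3 h4 h]]]]].
  by move: (sV a h1) (sV c h3) (outW b h2); rewrite !inE; lia.
by move: (sV b h2) (sV d h4) (outW c h3); rewrite !inE; lia.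
Qed.

(** Between two consecutive elements [j] and [x] of a block lies a gap that no
    other block may leave, since it would cross that block. The partition of the
    gap is therefore arbitrary and independent of the rest; and as [x] is the
    last point, the rest only has to avoid crossing what remains of the block
    once [x] is removed. *)
Lemma nc_sum_gap l (j x : 'I_n) B : (j < x)%N -> j \in B ->
  B \subset interval l j.+1 ->
  nc_sum (interval l x.+1 :\: (x |: B)) (x |: B) =
  nc_sum (interval j.+1 x) set0 * nc_sum (interval l j.+1 :\: B) B.
Proof.
move=> ltjx jB /subsetP sB; set G := interval j.+1 x; set E := _ :\: B.
have ljB y : y \in B -> (l <= y <= j)%N by move/sB; rewrite inE ltnS.
have lej : (l <= j)%N by have /andP[] := ljB j jB.
have dE : [disjoint G & E].
  rewrite -setI_eq0; apply/eqP/setP => y; rewrite !inE.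
  case: (y \in B) => /=; first by rewrite andbF.
  by apply/negP; lia.
have -> : interval l x.+1 :\: (x |: B) = G :|: E.
  apply/setP => y; rewrite !inE; case yB: (y \in B) => /=.
    by rewrite orbT /= orbF; move: (ljB y yB); lia.
  by rewrite orbF -val_eqE /=; lia.
have BG : [disjoint x |: B & G].
  rewrite -setI_eq0; apply/eqP/setP => y; rewrite !inE; apply/negP.
  by move=> /andP[/orP[/eqP->|/ljB]]; lia.
have EG V : V \subset E -> [disjoint V & G].
  by move=> VE; rewrite disjoint_sym; apply: disjointWr VE dE.
rewrite /nc_sum big_distrlr pair_big /=.
rewrite (reindex_onto (fun p => p.1 :|: p.2)
  (fun rho => (rho ::&: G, rho ::&: E))) /=; last first.
  move=> rho /andP[hp /noncrossingP hn]; apply/setP => V; rewrite !inE -andb_orr.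
  case Vr: (V \in rho) => //=; have VGE := partitionS hp Vr.
  apply/negbNE/negP; rewrite negb_or => /andP[/subsetPn[y yV yG] /subsetPn[z zV zE]].
  have yE : y \in E by have := subsetP VGE y yV; rewrite inE (negPf yG).
  have zG : z \in G by have := subsetP VGE z zV; rewrite inE (negPf zE) orbF.
  have jV : j \notin V by apply/negP => /(subsetP VGE); rewrite !inE jB ltnn.
  (* A block with points [y] below [j] and [z] in the gap crosses the block of
     [j] and [x]. *)
  have VB : V = x |: B.
    apply: hn (setU1r _ Vr) (setU11 _ _) _; apply/crossingP; exists y, j, z, x.
    rewrite !inE jB eqxx orbT; split => //.
    move: yE zG; rewrite !inE ltnS => /andP[_ /andP[_ leyj]] /andP[ltjz ltzx].
    rewrite ltjz ltzx ltn_neqAle leyj !andbT.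
    by apply: contraTneq yV => /val_inj->.
  by move: jV; rewrite VB !inE jB orbT.
have nGE V : V != set0 -> V \subset G -> V \subset E -> False.
  move=> /set0Pn[y yV] VG VE; move: dE; rewrite disjoints_subset => /subsetP/(_ y).
  by rewrite (subsetP VG) // inE (subsetP VE) //= => /(_ isT).
have nBE V : V \subset E -> B \subset V -> False.
  by move=> /subsetP VE /subsetP/(_ j jB)/VE; rewrite inE jB.
suff condE rho1 rho2 :
  partition (rho1 :|: rho2) (G :|: E) && noncrossing (x |: B |: (rho1 :|: rho2)) &&
  (((rho1 :|: rho2) ::&: G, (rho1 :|: rho2) ::&: E) == (rho1, rho2)) =
  partition rho1 G && noncrossing (set0 |: rho1) &&
  (partition rho2 E && noncrossing (B |: rho2)).
  apply: eq_big => [[rho1 rho2]|[rho1 rho2]] /=; first exact: condE.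
  rewrite condE => /andP[/andP[hp1 _] /andP[hp2 _]].
  rewrite /weight -bigU /=; first by apply: eq_bigl => V; rewrite !inE.
  rewrite disjoint_subset; apply/subsetP => V V1; rewrite inE; apply/negP => V2.
  exact: nGE (partition_neq0 hp1 V1) (partitionS hp1 V1) (partitionS hp2 V2).
rewrite noncrossing_set0U; apply/idP/idP.
  move=> /andP[/andP[hp /noncrossingP hn] /eqP[e1 e2]].
  have : partition rho1 G && partition rho2 E.
    rewrite -(partitionU _ _ dE) hp /=; apply/andP; split; apply/forall_inP => V.
      by rewrite -{1}e1 inE => /andP[].
    by rewrite -{1}e2 inE => /andP[].
  move=> /andP[hp1 hp2]; rewrite hp1 hp2 /=.
  apply/andP; split; apply/noncrossingP => V W.
    by move=> Vr Wr; apply: hn; rewrite !inE ?Vr ?Wr ?orbT.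
  have xB_notin V' : V' \in rho2 -> V' = x |: B -> False.
    by move=> Vr e; apply: (nBE V' (partitionS hp2 Vr)); rewrite e subsetUr.
  move=> /setU1P[->|Vr] /setU1P[->|Wr] // cVW.
  - case: (xB_notin W Wr); symmetry; apply: hn; rewrite ?inE ?eqxx ?Wr ?orbT //.
    exact: crossingS (subsetUr _ _) (subxx _) cVW.
  - case: (xB_notin V Vr); apply: hn; rewrite ?inE ?eqxx ?Vr ?orbT //.
    exact: crossingS (subxx _) (subsetUr _ _) cVW.
  by apply: hn => //; rewrite !inE ?Vr ?Wr !orbT.
move=> /andP[/andP[hp1 /noncrossingP hn1] /andP[hp2 /noncrossingP hn2]].
have := partitionU rho1 rho2 dE; rewrite hp1 hp2 => /and3P[hp _ _]; rewrite hp /=.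
have inside V W : V \in rho1 -> W \in x |: B |: rho2 -> ~~ crossing V W && ~~ crossing W V.
  move=> Vr Wr; apply: crossing_interval (partitionS hp1 Vr) _.
  by case/setU1P: Wr => [->//|Wr]; apply: EG; apply: partitionS Wr.
have outside W : W \in rho2 -> ~~ crossing (x |: B) W && ~~ crossing W (x |: B).
  move=> Wr; have WE := partitionS hp2 Wr.
  have leWj y : y \in W -> [/\ (y <= j)%N, y != j & y \notin B].
    move/(subsetP WE); rewrite !inE ltnS => /andP[yB /andP[_ leyj]]; split=> //.
    by apply: contraNneq yB => ->.
  apply/andP; split; apply/negP => /crossingP[a [b [c [d [h1 h2 h3 h4 h]]]]].
    have : B = W; last by move=> e; apply: (nBE W WE); rewrite e.
    apply: hn2; rewrite ?setU11 ?setU1r //; apply/crossingP; exists a, b, c, d.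
    have [dj _ _] := leWj d h4.
    have notx (y : 'I_n) : (y < d)%N -> y \in x |: B -> y \in B.
      by move=> yd /setU1P[e|//]; move: yd; rewrite e ltnNge (leq_trans dj (ltnW ltjx)).
    case/and3P: (h) => ltab ltbc ltcd; split=> //; apply: notx => //.
    exact: ltn_trans (ltn_trans ltab ltbc) ltcd.
  have : W = B; last by move=> e; apply: (nBE W WE); rewrite e.
  apply: hn2; rewrite ?setU11 ?setU1r //; apply/crossingP; exists a, b, c, j.
  have [cj nej _] := leWj c h3; have bB : b \in B.
    case/setU1P: h2 => // e; case/and3P: h; rewrite e => _ ltxc _.
    by have := ltn_trans (leq_trans ltxc cj) ltjx; rewrite ltnn.
  by case/and3P: h => ltab ltbc _; split; rewrite // ltab ltbc ltn_neqAle nej.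
apply/andP; split.
  apply/noncrossingP => V W; rewrite !in_setU1 !in_setU.
  case/or3P => [/eqP->|Vr|Vr] /or3P[/eqP->|Wr|Wr] // cVW.
  - by case/andP: (inside W (x |: B) Wr (setU11 _ _)) => _; rewrite cVW.
  - by case/andP: (outside W Wr); rewrite cVW.
  - by case/andP: (inside V (x |: B) Vr (setU11 _ _)); rewrite cVW.
  - exact: hn1.
  - by case/andP: (inside V W Vr (setU1r _ Wr)); rewrite cVW.
  - by case/andP: (outside V Vr) => _; rewrite cVW.
  - by case/andP: (inside W V Wr (setU1r _ Vr)) => _; rewrite cVW.
  - by apply: hn2 => //; rewrite setU1r.
apply/eqP; congr (_, _); apply/setP => V; rewrite !inE.
  apply/andP/idP => [[/orP[//|Vr] VG]|Vr]; last by rewrite Vr (partitionS hp1 Vr).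
  by case: (nGE V (partition_neq0 hp2 Vr) VG (partitionS hp2 Vr)).
apply/andP/idP => [[/orP[Vr|//] VE]|Vr]; last by rewrite Vr orbT (partitionS hp2 Vr).
by case: (nGE V (partition_neq0 hp1 Vr) (partitionS hp1 Vr) VE).
Qed.

(** Noncrossing partitions of the interval from [l] to [x], where the weight of the
    block [B] of the last point [x] is replaced by an arbitrary function [F] of
    its size. This freedom keeps track of elements already removed from the
    block, which makes a recursion removing them one at a time possible. *)
Definition pointed_sum l (x : 'I_n) (F : nat -> K) : K :=
  \sum_(B : {set 'I_n} | (x \in B) && (B \subset interval l x.+1))
     F #|B| * nc_sum (interval l x.+1 :\: B) B.

Definition is_max (A : {set 'I_n}) j := (j \in A) && [forall k in A, (k <= j)%N].

Lemma is_max_uniq A (j k : 'I_n) : is_max A j -> is_max A k -> j = k.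
Proof.
move=> /andP[jA /forall_inP hj] /andP[kA /forall_inP hk]; apply/val_inj/eqP.
by rewrite eqn_leq hk // hj.
Qed.

Lemma is_max_ex A : A != set0 -> exists j, is_max A j.
Proof.
case/set0Pn => i iA; exists [arg max_(k > i in A) (k : nat)].
case: (arg_maxnP (fun k : 'I_n => k : nat) iA) => k kA hk.
by apply/andP; split=> //; apply/forall_inP.
Qed.

(** Either the last point [x] is alone in its block, or [j] is the point of
    the block just below [x]. *)
Lemma pointed_sum_rec l (x : 'I_n) F : (l <= x)%N ->
  pointed_sum l x F = F 1 * nc_sum (interval l x) set0 +
    \sum_(j : 'I_n | (l <= j < x)%N)
      nc_sum (interval j.+1 x) set0 * pointed_sum l j (fun h => F h.+1).
Proof.
move=> lelx; rewrite /pointed_sum (bigD1 [set x]) /=; last first.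
  by rewrite set11 sub1set inE; lia.
congr (_ + _).
  rewrite cards1 nc_sum_set1; congr (_ * nc_sum _ _).
  by apply/setP => y; rewrite !inE -val_eqE /=; lia.
pose top (B : {set 'I_n}) := odflt x [pick j | is_max (B :\ x) j].
have topP (B : {set 'I_n}) (j : 'I_n) : j != x -> (top B == j) = is_max (B :\ x) j.
  move=> jx; rewrite /top; case: pickP => [k hk|hk] /=; last by rewrite hk eq_sym (negPf jx).
  by apply/eqP/idP => [<-//|hj]; apply: is_max_uniq hk hj.
rewrite (partition_big top (fun j : 'I_n => (l <= j < x)%N)) /=; last first.
  move=> B /andP[/andP[xB /subsetP BS] neB].
  have [|j jmax] := @is_max_ex (B :\ x).
    apply: contraNneq neB => e; rewrite eqEsubset sub1set xB andbT.
    by rewrite -setD_eq0 e.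
  have jx : j != x by move: jmax; rewrite /is_max !inE => /andP[/andP[]].
  have /eqP-> : top B == j by rewrite topP.
  move: jmax jx => /andP[]; rewrite !inE => /andP[_ /BS]; rewrite inE -val_eqE /=; lia.
apply: eq_bigr => j hj; rewrite mulr_sumr.
rewrite (reindex_onto (fun B => x |: B) (fun B => B :\ x)) /=; last first.
  by move=> B /andP[/andP[/andP[xB _] _] _]; rewrite setD1K.
have jx : j != x by rewrite -val_eqE /=; lia.
have condE (B : {set 'I_n}) :
  [&& x \in x |: B, x |: B \subset interval l x.+1 & x |: B != [set x]] && (top (x |: B) == j)
   && ((x |: B) :\ x == B) = (j \in B) && (B \subset interval l j.+1).
  rewrite topP // setU11 /=; case xB: (x \in B).
    have -> : ((x |: B) :\ x == B) = false.
      by apply/eqP => /setP/(_ x); rewrite xB !inE eqxx.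
    rewrite andbF; symmetry; apply/negP => /andP[_ /subsetP/(_ x xB)].
    by rewrite inE; lia.
  rewrite setU1K ?xB // eqxx andbT /is_max; case jB: (j \in B); last by rewrite andbF.
  have -> : x |: B != [set x].
    apply/eqP => /setP/(_ j); rewrite !inE jB orbT => /esym/eqP e.
    by rewrite e eqxx in jx.
  rewrite andbT /=; apply/andP/subsetP => [[/subsetP BS /forall_inP le_j] y yB|BS].
    by have := BS y (setU1r _ yB); have := le_j y yB; rewrite !inE; lia.
  split; last by apply/forall_inP => y /BS; rewrite inE; lia.
  by apply/subsetP => y /setU1P[->|/BS]; rewrite !inE; lia.
apply: eq_big => [B|B].
  by rewrite -condE -!andbA.
rewrite -!andbA => cond; have := condE B; rewrite -!andbA cond => /esym /andP[jB BS].
rewrite (nc_sum_gap _ jB BS); last by case/andP: hj.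
rewrite cardsU1 mulrCA; congr (_ * (F _ * _)).
have : x \notin B by apply/negP => /(subsetP BS); rewrite inE; lia.
by move=> ->.
Qed.

(** The recursion [pointed_sum_rec] is matched by the decomposition
    [lukasiewicz_convolution], where the height of a path records how many points
    the block of [x] has besides [x]. *)
Lemma lukasiewicz_nc_sum m : forall l, (l + m <= n)%N ->
  nc_sum (interval l (l + m)) set0 = lukasiewicz kappa m 0.
Proof.
elim/ltn_ind: m => m IHm l lm.
case: m IHm lm => [|m] IHm lm.
  rewrite lukasiewicz0 /nc_sum (_ : interval _ _ = set0); last first.
    by apply/setP => y; rewrite !inE; lia.
  rewrite (big_pred1 set0) /=; first by rewrite /weight big_set0.
  move=> rho; rewrite partition_set0 /=; case: eqP => [->|//].
  by rewrite noncrossing_set0U; apply/noncrossingP => V W; rewrite inE.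
have pointedE d : (d <= m)%N -> forall (x : 'I_n) F, nat_of_ord x = (l + d)%N ->
   pointed_sum l x F = \sum_(h < d.+1) F h.+1 * lukasiewicz kappa d h.
  elim/ltn_ind: d => d IHd led x F xE; rewrite pointed_sum_rec; last by lia.
  rewrite xE IHm; [|by lia|by lia].
  have -> : \sum_(j : 'I_n | (l <= j < l + d)%N)
      nc_sum (interval j.+1 (l + d)) set0 * pointed_sum l j (fun h => F h.+1)
    = \sum_(j < d) lukasiewicz kappa (d.-1 - j) 0 *
      \sum_(h < j.+1) F h.+2 * lukasiewicz kappa j h.
    rewrite -[RHS](big_mkord xpredT (fun j => lukasiewicz kappa (d.-1 - j) 0 *
      \sum_(h < j.+1) F h.+2 * lukasiewicz kappa j h)).
    transitivity (\sum_(l <= j < l + d) lukasiewicz kappa (d.-1 - (j - l)) 0 *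
      \sum_(h < (j - l).+1) F h.+2 * lukasiewicz kappa (j - l) h).
      rewrite (big_nat_widen _ _ n); last by have := ltn_ord x; lia.
      rewrite big_geq_mkord /=; apply: eq_big => [j|j hj]; first by rewrite andbC.
      rewrite (IHd (j - l)%N _ _ j (fun h => F h.+1)); [|by lia|by lia|by lia].
      have -> : (l + d = j.+1 + (d.-1 - (j - l)))%N by lia.
      by rewrite IHm //; have := ltn_ord x; lia.
    rewrite -[X in \sum_(X <= _ < _) _]add0n big_addn addKn.
    by apply: eq_bigr => j _; rewrite addnK.
  rewrite [RHS]big_ord_recl; congr (_ + _).
  case: d {IHd xE} led => [|d] led; first by rewrite !big_ord0.
  under [RHS]eq_bigr => h _ do rewrite lift0 lukasiewicz_convolution mulr_sumr.
  rewrite exchange_big /=; apply: eq_bigr => j _.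
  rewrite (big_ord_widen d.+1 (fun h => F h.+2 * lukasiewicz kappa j h)) ?ltn_ord //.
  rewrite mulr_sumr big_mkcond; apply: eq_bigr => h _; case: ifP => hj.
    by rewrite mulrCA.
  by rewrite (lukasiewicz_gt _ (n := j)) ?mulr0 //; lia.
have lx : (l + m < n)%N by lia.
rewrite addnS (@nc_sum_block _ (Ordinal lx)); last by rewrite inE /=; lia.
rewrite -/(pointed_sum l (Ordinal lx) kappa) (pointedE m) //.
rewrite (lukasiewiczS _ _ (ltnSn m)) add0r; apply: eq_bigr => s _.
by rewrite add0n.
Qed.
End NoncrossingSums.

Theorem moments_of_cumulants_lukasiewicz (K : comNzRingType) (kappa : nat -> K) n :
  moments_of_cumulants kappa n = lukasiewicz kappa n 0.
Proof.
rewrite -(@lukasiewicz_nc_sum _ kappa n n 0) ?add0n //; apply: eq_bigl => rho.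
rewrite noncrossing_set0U inE; congr (partition _ _ && _).
by apply/setP => y; rewrite !inE /= ltn_ord.
Qed.

(** * Free Appell polynomials *)

Lemma strong_recursion (T : Type) (F : nat -> (nat -> T) -> T) :
  T -> (forall n f f', (forall k, (k < n)%N -> f k = f' k) -> F n f = F n f') ->
  exists f, forall n, f n = F n f.
Proof.
move=> x0 Fext.
pose h := fix h n := if n is n'.+1 then rcons (h n') (F n' (nth x0 (h n'))) else [::].
have size_h n : size (h n) = n by elim: n => //= n IHn; rewrite size_rcons IHn.
exists (fun n => nth x0 (h n.+1) n) => n /=.
rewrite nth_rcons size_h ltnn eqxx; apply: Fext => k.
elim: n => // n IHn; rewrite ltnS /= !nth_rcons !size_h leq_eqVlt ltnn eqxx.
by case/orP => [/eqP->|lt_kn]; rewrite ?ltnn ?eqxx ?lt_kn //= IHn // nth_rcons size_h ltnn eqxx.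
Qed.

Section Expansion.
Variables (C : comNzRingType) (B : pzRingType) (iota : {rmorphism C -> B}).
Hypothesis iota_central : forall c x, x * iota c = iota c * x.
Variables (kappa : nat -> C) (c : nat -> B) (f : nat -> nat -> B) (w : nat -> B).

(** Multiplication by [c m] acts on the index [k] as one step of a Lukasiewicz path.
    The extra index [m] of [f] allows the multiplier and the family to change
    with time, as needed for words that alternate between two letters. *)
Lemma lukasiewicz_expansion n :
  w 0 = f 0 0 -> (forall m, w m.+1 = c m * w m) ->
  (forall m k, c m * f m k =
     f m.+1 k.+1 + \sum_(j < k.+1) iota (kappa j.+1) * f m.+1 (k - j)%N) ->
  w n = \sum_(h < n.+1) iota (lukasiewicz kappa n h) * f n h.
Proof.
move=> w0 wS cf; elim: n => [|n IHn]; first by rewrite big_ord1 lukasiewicz0 rmorph1 mul1r.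
rewrite wS IHn mulr_sumr.
under eq_bigr => h _ do rewrite mulrA iota_central -mulrA cf mulrDr.
rewrite big_split /=.
have -> : \sum_(h < n.+1) iota (lukasiewicz kappa n h) *
     (\sum_(j < h.+1) iota (kappa j.+1) * f n.+1 (h - j)%N) =
   \sum_(i < n.+2) iota (\sum_(s < n.+1) kappa s.+1 * lukasiewicz kappa n (i + s)%N) * f n.+1 i.
  under [RHS]eq_bigr => i _ do rewrite rmorph_sum mulr_suml.
  rewrite exchange_big /=.
  have swap (h : 'I_n.+1) : iota (lukasiewicz kappa n h) *
      (\sum_(j < h.+1) iota (kappa j.+1) * f n.+1 (h - j)%N) =
     \sum_(j < n.+1 | (j <= h)%N) iota (kappa j.+1 * lukasiewicz kappa n h) * f n.+1 (h - j).
    rewrite mulr_sumr (big_ord_widen n.+1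
      (fun j => iota (lukasiewicz kappa n h) * (iota (kappa j.+1) * f n.+1 (h - j)%N))) //.
    by apply: eq_bigr => j _; rewrite mulrA -rmorphM mulrC.
  rewrite (eq_bigr _ (fun h _ => swap h)) (exchange_big_dep xpredT) //=.
  apply: eq_bigr => j _.
  pose E i := iota (kappa j.+1 * lukasiewicz kappa n (i + j)%N) * f n.+1 i.
  rewrite -(big_mkord xpredT E).
  rewrite (@big_cat_nat _ _ _ (n.+1 - j)) //=; last by lia.
  rewrite [X in _ + X]big1_seq ?addr0; last first.
    move=> i; rewrite mem_index_iota /E => hi.
    by rewrite lukasiewicz_gt ?mulr0 ?rmorph0 ?mul0r //; lia.
  rewrite -(big_geq_mkord _ _ xpredT
    (fun h => iota (kappa j.+1 * lukasiewicz kappa n h) * f n.+1 (h - j)%N)).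
  rewrite -[X in \sum_(X <= _ < _) _]add0n big_addn; apply: eq_bigr => i _.
  by rewrite /E addnK.
under [RHS]eq_bigr => h _ do rewrite (lukasiewiczS _ _ (ltnSn n)) rmorphD mulrDl.
rewrite [RHS]big_split /=; congr (_ + _).
by rewrite [RHS]big_ord_recl /= rmorph0 mul0r add0r; apply: eq_bigr.
Qed.
End Expansion.

Section Appell.
Variables (C : comNzRingType) (B : pzRingType) (iota : {rmorphism C -> B}).
Hypothesis iota_central : forall c x, x * iota c = iota c * x.
Variables (phi : {additive B -> C}).
Hypothesis phi_iota : forall c x, phi (iota c * x) = c * phi x.
Variables (kappa : nat -> C).

(** The generating series of [p] is [(C(t) - t x)^-1] with
    [C(t) = 1 + sum_s kappa_s t^s]: these are the free Appell polynomials of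
    the distribution with free cumulants [kappa]. *)
Definition appell (x : B) (p : nat -> B) :=
  p 0 = 1 /\
  forall k, x * p k = p k.+1 + \sum_(j < k.+1) iota (kappa j.+1) * p (k - j)%N.

Lemma appell_ex x : exists p, appell x p.
Proof.
pose F n (p : nat -> B) := if n is k.+1
  then x * p k - \sum_(j < k.+1) iota (kappa j.+1) * p (k - j)%N else 1.
have [|p pE] := @strong_recursion B F 0.
  case=> //= n p q pq; rewrite pq //; congr (_ - _).
  by apply: eq_bigr => j _; rewrite pq // ltnS leq_subr.
by exists p; split=> [|k]; [rewrite pE | rewrite [p k.+1]pE /= subrK].
Qed.

(** Expanding [x ^+ n] along [p] and applying [phi] gives the moment [n], which is
    already the coefficient of [p 0]; since the coefficient of [p n] is [1], the
    values [phi (p n)] vanish one after the other. *)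
Lemma appell_centered x p : phi 1 = 1 -> appell x p ->
  (forall n, phi (x ^+ n) = moments_of_cumulants kappa n) ->
  forall k, (0 < k)%N -> phi (p k) = 0.
Proof.
move=> phi1 [p0 pS] phix; elim/ltn_ind => [[//|k]] IHk _.
have /(congr1 phi) := @lukasiewicz_expansion _ _ iota iota_central kappa (fun=> x) (fun=> p)
  (fun n => x ^+ n) k.+1 (esym p0) (exprS x) (fun _ => pS).
rewrite phix moments_of_cumulants_lukasiewicz raddf_sum big_ord_recl big_ord_recr /=.
rewrite big1 => [|h _]; last by rewrite phi_iota IHk ?mulr0 //= /bump /=; have := ltn_ord h; lia.
rewrite p0 !phi_iota phi1 mulr1 lukasiewicz_diag mul1r add0r -[LHS]addr0.
by move/addrI/esym.
Qed.
End Appell.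

(** * Alternating words in free variables *)

Section AlternatingWords.
Variables (C : numClosedFieldType) (B : pzRingType) (iota : {rmorphism C -> B}).
Hypothesis iota_central : forall c x, x * iota c = iota c * x.
Variables (phi : {additive B -> C}).
Hypothesis phi_iota : forall c x, phi (iota c * x) = c * phi x.
Variable alg : bool -> B -> Prop.
Hypothesis alg_free : freely_independent phi alg.

Definition centered t x := alg t x /\ phi x = 0.

Definition centered_word t (s : seq B) :=
  s <> [::] /\ forall j, (j < size s)%N -> centered (t (+) odd j) s`_j.

(** Sums of alternating products of centered letters whose first letter is of
    type [t]. *)
Inductive reduced (t : bool) : B -> Prop :=
| reduced0 : reduced t 0
| reduced_word s : centered_word t s -> reduced t (\prod_(x <- s) x)
| reducedD x y : reduced t x -> reduced t y -> reduced t (x + y).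

Lemma phi_reduced t x : reduced t x -> phi x = 0.
Proof.
elim=> [|s [s0 sc]|y z _ IHy _ IHz]; [exact: raddf0| |by rewrite raddfD IHy IHz addr0].
rewrite (big_nth 0); apply: (alg_free (i := fun j => t (+) odd j)).
- by case: s s0 {sc}.
- by move=> j /sc[].
- by move=> j /sc[].
- by move=> j _ /=; case: t {sc}; case: (odd j).
Qed.

Lemma reduced_letter t x : centered t x -> reduced t x.
Proof.
move=> xc; rewrite (_ : x = \prod_(y <- [:: x]) y); last by rewrite big_seq1.
by apply: reduced_word; split=> // -[|//] _; rewrite addbF.
Qed.

Lemma reducedM t x y : centered t x -> reduced (~~ t) y -> reduced t (x * y).
Proof.
move=> xc; elim=> [|s [s0 sc]|{}y z _ IHy _ IHz].
- by rewrite mulr0; apply: reduced0.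
- rewrite (_ : _ * _ = \prod_(y <- x :: s) y); last by rewrite big_cons.
  apply: reduced_word; split=> // -[|j] /=; first by rewrite addbF.
  by move=> /sc; rewrite addNb addbN.
- by rewrite mulrDr; apply: reducedD.
Qed.

Lemma reduced_sum t n (x : nat -> B) :
  (forall i, (i < n)%N -> reduced t (x i)) -> reduced t (\sum_(i < n) x i).
Proof.
elim: n => [|n IHn] hx; first by rewrite big_ord0; apply: reduced0.
rewrite big_ord_recr; apply: reducedD; last exact: hx.
by apply: IHn => i lt_in; apply: hx; apply: ltnW.
Qed.

Variables (kappa : nat -> C) (X : B) (p : nat -> B).
Hypothesis pA : appell iota kappa X p.
Hypothesis p_centered : forall k, centered true (p k.+1).
Variables (N : nat) (D : bool -> B).
Hypothesis N_gt0 : (0 < N)%N.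
Hypothesis DD : forall a a', D a * D a' = if a == a' then D a else 0.
Let b a := iota N%:R * D a.
Hypothesis b_centered : forall a, centered false (b a - 1).

(** Let [S] be the swap of the two values of [a], let [d] send [z] to
    [a |-> (b a - 1) * z (~~ a)], and put [P = sum_i p_(i+1) (t S)^i]. Then [z] is
    the series [(1 - t P d)^-1 (1 + t P S)] applied to the constant [1].
    Its coefficients are reduced because the letters of [P] and [d] are
    centered and alternate. The recursion expresses that [1 + t P S] is
    the inverse of [C(t S) - t S X], where [C] is the series
    [1 + sum_s kappa_s t^s]. The auxiliary series [g = 1 + d z] collects what
    may follow a letter of [P]: a word either ends there or goes on with a
    letter [b a - 1]. *)
Lemma alternating_sums :
  exists z f : nat -> bool -> B, [/\
    forall a k, f k a = b a * z k (~~ a),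
    forall a, z 0 a = 1,
    forall a k, reduced true (z k.+1 a) &
    forall a k, X * f k a = z k.+1 a +
      \sum_(j < k.+1) iota (kappa j.+1) * f (k - j)%N (a (+) odd j)].
Proof.
pose F n (g : nat -> {ffun bool -> B}) := if n is k.+1
  then [ffun a => (b a - 1) * \sum_(i < k.+1) p i.+1 * g (k - i)%N (~~ a (+) odd i)]
  else [ffun a => b a].
have [|g gE] := @strong_recursion {ffun bool -> B} F [ffun=> 0].
  case=> //= n g h gh; apply/ffunP => a; rewrite !ffunE; congr (_ * _).
  by apply: eq_bigr => i _; rewrite gh // ltnS leq_subr.
pose z n a := if n is k.+1 then \sum_(i < k.+1) p i.+1 * g (k - i)%N (a (+) odd i) else 1.
pose f k a := \sum_(i < k.+1) p i * g (k - i)%N (a (+) odd i).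
have g0 a : g 0 a = b a by rewrite gE ffunE.
have gS k a : g k.+1 a = (b a - 1) * z k.+1 (~~ a) by rewrite gE ffunE.
have [p0 pS] := pA.
exists z, f; split=> //.
- move=> a [|k]; first by rewrite /f big_ord1 p0 mul1r g0 addbF mulr1.
  rewrite /f big_ord_recl p0 mul1r subn0 addbF gS mulrBl mul1r.
  rewrite [X in _ - z _ _ + X](_ : _ = z k.+1 (~~ a)) ?subrK //.
  by apply: eq_bigr => i _; rewrite lift0 subSS addbN addNb.
- move=> a k; elim/ltn_ind: k a => k IHk a; 
  apply: (@reduced_sum _ _ (fun i => p i.+1 * g (k - i)%N (a (+) odd i))) => i lt_ik.
  case: (k - i)%N (leq_subr i k) => [|m] lt_mk.
    rewrite g0 -[b _](subrK 1) mulrDr mulr1; apply: reducedD.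
      by apply: reducedM (p_centered _) _; apply: reduced_letter; apply: b_centered.
    exact: reduced_letter (p_centered _).
  rewrite gS; apply: reducedM (p_centered _) _; apply: reducedM (b_centered _) _.
  exact: IHk.
- move=> a k; rewrite /f mulr_sumr.
  under eq_bigr => i _ do rewrite mulrA pS mulrDl mulr_suml.
  rewrite big_split /=; congr (_ + _).
  under [RHS]eq_bigr => j _ do rewrite mulr_sumr.
  pose E i j := iota (kappa j.+1) * p (i - j)%N * g (k - i)%N (a (+) odd i).
  transitivity (\sum_(i < k.+1) \sum_(j < k.+1 | (j <= i)%N) E i j).
    apply: eq_bigr => i _; rewrite (big_ord_widen k.+1 (E i)) //.
  rewrite (exchange_big_dep xpredT) //=; apply: eq_bigr => j _.
  rewrite -(big_geq_mkord _ _ xpredT (fun i => E i j)).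
  rewrite -[X in \sum_(X <= _ < _) _]add0n big_addn big_mkord subSn; last by rewrite -ltnS.
  apply: eq_bigr => i _; rewrite /E addnK mulrA oddD.
  by rewrite addnC subnDA -addbA [odd i (+) _]addbC.
Qed.

(** With [D (~~ a) * X] as multiplier, the term of [alternating_sums] with index
    [j] survives only for odd [j], where the idempotents agree; since [j] stands
    for the cumulant of order [j.+1], the even orders remain. As [b a = N D a],
    the leading term is [N^-1] times the next [f], and rescaling [f k] by
    [N^-k] to make its coefficient [1] changes [kappa s] by [N^(1-s)]. *)
Definition even_cumulant s := if odd s then 0 else N%:R * (N%:R^-1) ^+ s * kappa s.

(** The rescaled [f] of [alternating_sums] satisfies the recursion with the
    cumulants [even_cumulant], and its terms of positive degree are sums of
    reduced words once [b a] is split as [(b a - 1) + 1]. *)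
Lemma alternating_moments a (w : nat -> B) n : phi 1 = 1 ->
  w 0 = b a -> (forall m, w m.+1 = D (~~ a (+) odd m) * X * w m) ->
  phi (w n) = moments_of_cumulants even_cumulant n.
Proof.
move=> phi1 w0 wS; have [z [f [fE z0 z_red Xf]]] := alternating_sums.
have N0 : N%:R != 0 :> C by rewrite pnatr_eq0 -lt0n.
have fS k e : phi (f k.+1 e) = 0.
  rewrite fE -[b e](subrK 1) mulrDl mul1r raddfD (phi_reduced (z_red _ _)) addr0.
  by apply: phi_reduced (reducedM (b_centered e) _); apply: z_red.
pose q m k := iota ((N%:R^-1) ^+ k) * f k (a (+) odd m).
rewrite (@lukasiewicz_expansion _ _ iota iota_central even_cumulant
  (fun m => D (~~ a (+) odd m) * X) q w n) //.
- rewrite raddf_sum big_ord_recl big1 ?addr0; last first.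
    by move=> h _; rewrite !phi_iota fS !mulr0.
  rewrite !phi_iota fE z0 mulr1 mul1r -[b _](subrK 1) raddfD phi1.
  by case: (b_centered (a (+) odd n)) => _ ->; rewrite add0r mulr1 moments_of_cumulants_lukasiewicz.
- by rewrite /q rmorph1 mul1r fE z0 mulr1 addbF.
move=> m k; rewrite /q mulrA iota_central -mulrA -[_ * X * _]mulrA Xf.
set e := a (+) odd m; rewrite addNb -/e mulrDr mulrDr; congr (_ + _).
  rewrite fE addbN -/e negbK /b exprSr rmorphM -mulrA; congr (_ * _).
  by rewrite !mulrA -rmorphM mulVf // rmorph1 mul1r.
rewrite !mulr_sumr; apply: eq_bigr => j _.
have -> : D (~~ e) * (iota (kappa j.+1) * f (k - j)%N (e (+) odd j)) =
    if odd j then iota (kappa j.+1) * f (k - j)%N (~~ e) else 0.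
  rewrite mulrA iota_central -mulrA fE /b !mulrA -[_ * D _ * iota _]mulrA iota_central.
  rewrite !mulrA -[_ * D _ * D _]mulrA DD; case: (odd j); last first.
    by rewrite addbF; case: (e); rewrite /= mulr0 mul0r.
  by rewrite addbT eqxx fE /b !mulrA.
rewrite /even_cumulant addbN -/e /=; case: (odd j) => /=; last first.
  by rewrite rmorph0 mul0r mulr0.
rewrite !mulrA -!rmorphM; congr (iota _ * _).
by rewrite exprS mulVKf // [RHS]mulrAC -exprD subnKC // -ltnS.
Qed.
End AlternatingWords.

(** * Matrices *)

Section MatrixModel.
Variables (C : numClosedFieldType) (A : algType C) (tau : {scalar A}) (n : nat).


Definition scalar_embedding : {rmorphism C -> 'M[A]_n} := (@scalar_mx A n \o in_alg A).

Lemma mulr_scalar_embedding c (M : 'M[A]_n) : scalar_embedding c * M = c%:A *: M.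
Proof. exact: mul_scalar_mx. Qed.

Lemma scalar_embedding_central c (M : 'M[A]_n) :
  M * scalar_embedding c = scalar_embedding c * M.
Proof.
rewrite mulr_scalar_embedding; apply/matrixP => i j.
rewrite (_ : M * _ = M *m (c%:A)%:M) //.
rewrite [LHS]mxE (bigD1 j) //= big1 => [|k kj]; last by rewrite mxE (negPf kj) mulr0.
by rewrite !mxE eqxx mulr1n addr0 -scalerAr -scalerAl mulr1 mul1r.
Qed.

Lemma mx_state_is_additive : zmod_morphism (mx_state tau : 'M[A]_n -> C).
Proof.
move=> M M'; rewrite /mx_state -mulrBr -sumrB; congr (_ * _).
by apply: eq_bigr => h _; rewrite !mxE raddfB.
Qed.
HB.instance Definition _ :=
  GRing.isZmodMorphism.Build 'M[A]_n C (mx_state tau) mx_state_is_additive.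

Lemma mx_state_scalar c (M : 'M[A]_n) :
  mx_state tau (scalar_embedding c * M) = c * mx_state tau M.
Proof.
rewrite mulr_scalar_embedding /mx_state mulrCA [in RHS]mulr_sumr; congr (_ * _).
by apply: eq_bigr => h _; rewrite mxE -scalerAl mul1r linearZ.
Qed.

Lemma mx_state1 : (0 < n)%N -> tau 1 = 1 -> mx_state tau (1 : 'M[A]_n) = 1.
Proof.
move=> n0 tau1; rewrite /mx_state (eq_bigr (fun=> 1)) => [|h _]; last by rewrite mxE eqxx.
by rewrite sumr_const card_ord mulVf // pnatr_eq0 -lt0n.
Qed.

Lemma mx_state_delta i : tau 1 = 1 -> mx_state tau (delta_mx i i : 'M[A]_n) = n%:R^-1.
Proof.
move=> tau1; rewrite /mx_state (bigD1 i) //= big1 => [|h hi].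
  by rewrite mxE eqxx tau1 addr0 mulr1.
by rewrite mxE (negPf hi) raddf0.
Qed.

Lemma appell_gen (kappa : nat -> C) (X : 'M[A]_n) p :
  appell scalar_embedding kappa X p -> forall k, unital_algebra_gen X (p k).
Proof.
move=> [p0 pS] k P [P1 PD PZ PM] PX; elim/ltn_ind: k => [[|k]] IHk; first by rewrite p0.
have -> : p k.+1 = X * p k + \sum_(j < k.+1) scalar_embedding (- kappa j.+1) * p (k - j)%N.
  rewrite pS -addrA -big_split big1 ?addr0 // => j _.
  by rewrite rmorphN mulNr; apply: subrr.
apply: (PD); first by apply: PM => //; apply: IHk.
have P0 : P 0 by rewrite -(scale0r (1 : 'M[A]_n)) -(scale0r (1 : A)); apply: PZ.
apply: big_ind => // j _; rewrite mulr_scalar_embedding; apply: PZ.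
by apply: IHk; rewrite ltnS leq_subr.
Qed.

Lemma complex_matrix_centered_delta i :
  complex_matrix (scalar_embedding n%:R * delta_mx i i - 1 : 'M[A]_n).
Proof.
exists (n%:R *: delta_mx i i - 1%:M); apply/matrixP => k l.
rewrite mulr_scalar_embedding !mxE scalerBl; congr (_ - _).
  by rewrite -scalerAl mul1r; case: (_ && _); rewrite /= ?mulr1 ?mulr0 ?scaler0 ?scale0r.
by case: (k == l); rewrite ?scale1r ?scale0r.
Qed.

Variables (X : 'M[A]_n) (sigma : 'I_n -> 'I_n).
Hypotheses (sigmaK : involutive sigma) (sigma_neq : forall i, sigma i != i).

Definition transposed_part : 'M[A]_n :=
  \matrix_(i, j) if j == sigma i then X j i else 0.
Local Notation Y := transposed_part.

Definition bounce (i : 'I_n) a := if a then sigma i else i.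

Lemma bounceN i a : bounce i (~~ a) = sigma (bounce i a).
Proof. by case: a => //=; rewrite sigmaK. Qed.

Lemma mul_transposed_part (M : 'M[A]_n) i j : (Y * M) i j = X (sigma i) i * M (sigma i) j.
Proof.
rewrite mxE (bigD1 (sigma i)) //= mxE eqxx big1 ?addr0 // => k ki.
by rewrite mxE (negPf ki) mul0r.
Qed.

Lemma transposed_part_support i k j :
  j != bounce i (~~ odd k) -> (Y ^+ k) j (sigma i) = 0.
Proof.
elim: k j => [|k IHk] j hj; first by rewrite mxE (negPf hj).
rewrite exprS mul_transposed_part IHk ?mulr0 //.
by apply: contra_neq hj => e; rewrite -[j]sigmaK e -bounceN.
Qed.

(** The word [w k] and the power [Y ^+ k] multiply the same entries of [X]: along
    the path [i, sigma i, i, ...] the entry of [Y] from [l] to [sigma l] is the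
    entry of [X] from [sigma l] to [l]. *)
Lemma transposed_part_word (w : nat -> 'M[A]_n) i k :
  w 0 = scalar_embedding n%:R * delta_mx i i ->
  (forall m, w m.+1 = delta_mx (bounce i (~~ odd m)) (bounce i (~~ odd m)) * X * w m) ->
  forall l j, w k l j = if j == i then n%:R *: (Y ^+ k) (sigma l) (sigma i) else 0.
Proof.
move=> w0 wS; elim: k => [|k IHk] l j.
  rewrite w0 mulr_scalar_embedding !mxE (inj_eq (can_inj sigmaK)) -scalerAl mul1r andbC.
  by case: (j == i) => //=; rewrite mulr0n scaler0.
set e := bounce i (~~ odd k).
have -> : w k.+1 l j = if l == e then X e (sigma e) * w k (sigma e) j else 0.
  rewrite wS -mulrA [LHS]mxE (bigD1 e) //= big1 => [|h he]; last first.
    by rewrite mxE (negPf he) andbF mul0r.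
  rewrite mxE eqxx andbT addr0; case: (l == e); last by rewrite mul0r.
  rewrite mul1r [LHS]mxE (bigD1 (sigma e)) //= big1 ?addr0 // => h he.
  rewrite IHk transposed_part_support ?scaler0 ?if_same ?mulr0 //.
  by apply: contra_neq he => he; rewrite /e -he sigmaK.
rewrite IHk; case: (j == i); last by rewrite mulr0 if_same.
rewrite exprS mul_transposed_part !sigmaK; case: eqP => [->|/eqP le]; last first.
  by rewrite transposed_part_support ?mulr0 ?scaler0.
by rewrite scalerAr.
Qed.

Lemma transposed_part_moments (kappa : nat -> C) : tau 1 = 1 ->
  free_from_complex_matrices tau X ->
  (forall k, mx_state tau (X ^+ k) = moments_of_cumulants kappa k) ->
  forall i k, tau ((Y ^+ k) i i) = moments_of_cumulants (even_cumulant kappa n) k.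
Proof.
move=> tau1 Xfree Xmom i k; have n0 : (0 < n)%N by apply: leq_ltn_trans (ltn_ord i).
have nC0 : n%:R != 0 :> C by rewrite pnatr_eq0 -lt0n.
pose D a := delta_mx (bounce (sigma i) a) (bounce (sigma i) a) : 'M[A]_n.
have [p pA] := appell_ex scalar_embedding kappa X.
have phi1 := mx_state1 n0 tau1.
have DD a a' : D a * D a' = if a == a' then D a else 0.
  rewrite /D -[LHS]/(_ *m _) mul_delta_mx_cond.
  case: (eqVneq a a') => [->|aa']; first by rewrite eqxx mulr1n.
  have -> : bounce (sigma i) a == bounce (sigma i) a' = false; last by rewrite mulr0n.
  have -> : a' = ~~ a by case: (a) (a') aa' => -[].
  by rewrite bounceN eq_sym (negPf (sigma_neq _)).
have p_centered k' : centered (mx_state tau)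
    (fun s : bool => if s then unital_algebra_gen X else @complex_matrix C A n) true (p k'.+1).
  split; first by apply: appell_gen pA _.
  exact: (appell_centered scalar_embedding_central mx_state_scalar phi1 pA Xmom (k := k'.+1)).
have b_centered a : centered (mx_state tau)
    (fun s : bool => if s then unital_algebra_gen X else @complex_matrix C A n) false
    (scalar_embedding n%:R * D a - 1).
  split; first exact: complex_matrix_centered_delta.
  change (mx_state tau (scalar_embedding n%:R * D a - 1) = 0).
  rewrite mx_state_is_additive mx_state_scalar [mx_state tau (D a)]mx_state_delta // phi1.
  by rewrite mulfV // subrr.
pose w := fix w m := if m is m'.+1 then D (~~ odd m') * X * w m'
                     else scalar_embedding n%:R * D false.
have <- : mx_state tau (w k) = moments_of_cumulants (even_cumulant kappa n) k.
  exact: (alternating_moments scalar_embedding_central mx_state_scalar Xfree pA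
    p_centered n0 DD b_centered (a := false) (w := w) k phi1).
have wE := @transposed_part_word w (sigma i) k erefl (fun m => erefl).
rewrite /mx_state (bigD1 (sigma i)) //= big1 => [|h hi]; last first.
  by rewrite wE (negPf hi) raddf0.
by rewrite wE eqxx sigmaK linearZ /= addr0 mulKf.
Qed.
End MatrixModel.

(** * Cumulants of the free convolution *)

Lemma eq_moments_of_cumulants (K : comNzRingType) (kappa kappa' : nat -> K) n :
  (forall s, (0 < s)%N -> kappa s = kappa' s) ->
  moments_of_cumulants kappa n = moments_of_cumulants kappa' n.
Proof.
move=> e; apply: eq_bigr => pi pi_nc; apply: eq_bigr => V Vpi.
by rewrite e // (NC_block_gt0 pi_nc).
Qed.

Lemma free_conv_dilations (C : numClosedFieldType) (mu : nat -> C) (N n : nat) :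
  (0 < N)%N ->
  free_conv (free_conv_power (dilation (N%:R^-1) mu) (N%:R / 2%:R))
            (free_conv_power (dilation (- N%:R^-1) mu) (N%:R / 2%:R)) n =
  moments_of_cumulants (even_cumulant (free_cumulant mu) N) n.
Proof.
move=> N0; apply: eq_moments_of_cumulants => s s0.
rewrite !free_cumulant_conv_power // !free_cumulant_dilation // /even_cumulant.
rewrite exprNn -signr_odd; case: (odd s); first by rewrite expr1 mulN1r mulNr mulrN subrr.
rewrite expr0 mul1r -mulrDl -[RHS]mulrA; congr (_ * _).
by rewrite -mulr2n -[_ *+ 2]mulr_natr mulfVK // pnatr_eq0.
Qed.

Theorem proposition4p11 (R : realType) (A : algType R[i]) (star : A -> A)
  (tau : {scalar A}) (Hstar : is_star star) (Htau1 : tau 1 = 1)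
  (Htr : tracial tau) (G : finGroupType) (X : 'M[A]_#|G|) (mu : nat -> R[i])
  (Xsa : selfadjoint star X) (Xfree : free_from_complex_matrices tau X)
  (Xmu : distribution (mx_state tau) X =1 mu) (g : G)
  (gS : g \in [set h : G | (h == h^-1)%g & (h != 1)%g]) :
  distribution (mx_state tau) (left_circulant g X^T) =1
  free_conv
    (free_conv_power (dilation (#|G|%:R^-1) mu) (#|G|%:R / 2%:R))
    (free_conv_power (dilation (- #|G|%:R^-1) mu) (#|G|%:R / 2%:R)).
Proof.
have /andP[/eqP gV g1] : (g == g^-1)%g && (g != 1)%g by move: gS; rewrite inE.
have G0 : (0 < #|G|)%N by apply/card_gt0P; exists g.
pose sigma (i : 'I_#|G|) := enum_rank (g * enum_val i)%g.
have sigmaK : involutive sigma.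
  by move=> i; rewrite /sigma enum_rankK {1}gV mulKg enum_valK.
have sigma_neq i : sigma i != i.
  apply: contraNneq g1 => /(congr1 enum_val); rewrite enum_rankK => e.
  by rewrite -(mulg1 g) -(mulgV (enum_val i)) mulgA e mulgV.
have -> : left_circulant g X^T = transposed_part X sigma.
  apply/matrixP => i j; rewrite !mxE -(can_eq enum_rankK) enum_valK.
  by case: eqP.
move=> n; rewrite free_conv_dilations // /distribution /mx_state.
have Xmom k : mx_state tau (X ^+ k) = moments_of_cumulants (free_cumulant mu) k.
  case: k => [|k]; last by rewrite -/(distribution _ _ _) Xmu moment_cumulant.
  by rewrite mx_state1 // moments_of_cumulants_lukasiewicz lukasiewicz0.
rewrite (eq_bigr _ (fun i _ => transposed_part_moments sigmaK sigma_neq Htau1 Xfree Xmom i n)).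
by rewrite sumr_const card_ord -[X in _ * X = _]mulr_natl mulKf // pnatr_eq0 -lt0n.
Qed.
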